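(* Let $n\in\mathbb N_0$, let $q\in\mathbb C$ with $q\ne0$, $|q|\ne1$, and let $\alpha,\beta\in\mathbb C$, such that no denominator below vanishes. Then $$P_n^{(\alpha,\beta)}\left(\tfrac12(q^{\frac12}+q^{-\frac12})|q^2\right)=\left(q^{\alpha}\right)^n\frac{(q^{\alpha+1},-q^{\beta+1};q)_n}{(q,-q^{\alpha+\beta+1};q)_n},$$ $$P_n^{(\alpha,\beta)}\left(-\tfrac12(q^{\frac12}+q^{-\frac12})|q^2\right)=\left(-q^{\alpha}\right)^n\frac{(-q^{\alpha+1},q^{\beta+1};q)_n}{(q,-q^{\alpha+\beta+1};q)_n},$$ $$P_n^{(\alpha,\beta)}\left(\tfrac12(q^{\alpha+\frac12}+q^{-\alpha-\frac12})|q^2\right)=\frac{(q^{\alpha+1},-q^{\alpha+1};q)_n}{(q,-q;q)_n},$$ $$P_n^{(\alpha,\beta)}\left(-\tfrac12(q^{\beta+\frac12}+q^{-\beta-\frac12})|q^2\right)=\left(-q^{\alpha-\beta}\right)^n\frac{(q^{\beta+1},-q^{\beta+1};q)_n}{(q,-q;q)_n}.$$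
   Context: Complex powers of $q$: fix a logarithm $\log q$ and set $q^s:=\exp(s\log q)$. Notation: $(a;q)_n:=\prod_{k=0}^{n-1}(1-aq^k)$, and $(a_1,\dots,a_r;q)_n:=\prod_i (a_i;q)_n$. Askey--Wilson polynomials: for $x=\frac12(z+z^{-1})$, $z\in\mathbb C\setminus\{0\}$, $$p_n(x;a,b,c,d|q):=a^{-n}(ab,ac,ad;q)_n\sum_{k=0}^n\frac{(q^{-n},q^{n-1}abcd,az,az^{-1};q)_k}{(q,ab,ac,ad;q)_k}q^k,$$ where $(ab;q)_n/(ab;q)_k$ is read as $(abq^k;q)_{n-k}$ (likewise for $ac$, $ad$), so that $p_n$ is always defined. Continuous $q$-Jacobi polynomials: $$P_n^{(\alpha,\beta)}(x|q):=\frac{q^{(\frac{\alpha}{2}+\frac14)n}}{(q,-q^{\frac{\alpha+\beta+1}{2}},-q^{\frac{\alpha+\beta+2}{2}};q)_n}\,p_n\left(x;q^{\frac{\alpha}{2}+\frac14},q^{\frac{\alpha}{2}+\frac34},-q^{\frac{\beta}{2}+\frac14},-q^{\frac{\beta}{2}+\frac34}\big|q\right).$$ $P_n^{(\alpha,\beta)}(x|q^2)$ means that $q$ is replaced by $q^2$ in this definition, with $(q^2)^s:=q^{2s}$. *)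

(* Defs.v *)
From mathcomp Require Import all_boot all_order all_algebra.
From mathcomp.real_closed Require Export complex.
From mathcomp Require Import reals sequences exp trigo ring.

Set Implicit Arguments.
Unset Strict Implicit.
Unset Printing Implicit Defensive.

Import Order.TTheory GRing.Theory Num.Theory.
Local Open Scope ring_scope.
Local Open Scope complex_scope.

Section QPochhammer.
Variable F : fieldType.

Definition qpoch (a q : F) (n : nat) : F := \prod_(k < n) (1 - a * q ^+ k).

Definition qpochs (s : seq F) (q : F) (n : nat) : F :=
  \prod_(a <- s) qpoch a q n.

End QPochhammer.

Section AskeyWilson.
Variable F : numClosedFieldType.

(* The quotient (ab;q)_n / (ab;q)_k is written (ab q^k;q)_(n-k), and likewise
   for ac and ad, so that no condition on a, b, c, d (except a <> 0) is
   needed. *)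
Definition askey_wilson_z (n : nat) (a b c d q z : F) : F :=
  a ^- n *
  \sum_(k < n.+1)
     qpochs [:: a * b * q ^+ k; a * c * q ^+ k; a * d * q ^+ k] q (n - k)
     * (qpochs [:: q ^- n; q ^ (n%:Z - 1) * (a * b * c * d); a * z; a * z^-1] q k
        / qpoch q q k)
     * q ^+ k.

(* A solution z of x = (z + 1/z) / 2; the other one is its inverse. *)
Definition joukowski_inv (x : F) : F := x + sqrtC (x ^+ 2 - 1).

Definition askey_wilson (n : nat) (a b c d q x : F) : F :=
  askey_wilson_z n a b c d q (joukowski_inv x).

Lemma askey_wilson_zV n (a b c d q z : F) :
  askey_wilson_z n a b c d q z^-1 = askey_wilson_z n a b c d q z.
Proof.
congr (_ * _); apply: eq_bigr => k _; congr (_ * (_ / _) * _).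
by rewrite /qpochs !big_cons invrK big_nil !mulr1; do 2 congr (_ * _); rewrite mulrC.
Qed.

Lemma joukowski_invK (x : F) :
  joukowski_inv x != 0 /\ x = (joukowski_inv x + (joukowski_inv x)^-1) / 2.
Proof.
have e : joukowski_inv x * (x - sqrtC (x ^+ 2 - 1)) = 1.
  by rewrite mulrC -subr_sqr sqrtCK subKr.
have nz : joukowski_inv x != 0.
  by apply/eqP => z0; move/eqP: e; rewrite z0 mul0r eq_sym oner_eq0.
split=> //; apply: (mulIf (_ : 2 != 0 :> F)); first by rewrite pnatr_eq0.
rewrite mulfVK ?pnatr_eq0 //.
have -> : (joukowski_inv x)^-1 = x - sqrtC (x ^+ 2 - 1).
  by apply: (mulfI nz); rewrite e mulfV.
by rewrite /joukowski_inv addrACA subrr addr0 mulr_natr mulr2n.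
Qed.

(* The value at x = (z + 1/z) / 2 does not depend on the choice of z. *)
Lemma askey_wilsonE n (a b c d q z : F) : z != 0 ->
  askey_wilson n a b c d q ((z + z^-1) / 2) = askey_wilson_z n a b c d q z.
Proof.
move=> z0; rewrite /askey_wilson; set x := (z + z^-1) / 2.
have [w0 xE] := joukowski_invK x; move: w0 xE; set w := joukowski_inv x => w0.
rewrite /x => /(mulIf (invr_neq0 (_ : 2 != 0 :> F))) E.
have {}E : z + z^-1 = w + w^-1 by apply: E; rewrite pnatr_eq0.
have /eqP : (w - z) * (w - z^-1) = 0.
  have -> : (w - z) * (w - z^-1) = w * (w + w^-1 - (z + z^-1)).
    by field; rewrite z0 w0.
  by rewrite E subrr mulr0.
rewrite mulf_eq0 !subr_eq0 => /orP[/eqP-> //|/eqP->].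
exact: askey_wilson_zV.
Qed.

End AskeyWilson.

Section ContinuousQJacobi.
Variable R : realType.

Definition cexp (z : R[i]) : R[i] :=
  (expR (complex.Re z))%:C * (cos (complex.Im z) +i* sin (complex.Im z)).

(* q^s for the branch given by the logarithm l of q. *)
Definition qpow (l s : R[i]) : R[i] := cexp (s * l).

Definition cqJacobi_den (q l : R[i]) (n : nat) (alpha beta : R[i]) : R[i] :=
  qpochs [:: q; - qpow l ((alpha + beta + 1) / 2);
             - qpow l ((alpha + beta + 2) / 2)] q n.

(* In the base q, with complex powers of q taken with the logarithm l. *)
Definition cqJacobi (q l : R[i]) (n : nat) (alpha beta x : R[i]) : R[i] :=
  qpow l ((alpha / 2 + 1 / 4) * n%:R) / cqJacobi_den q l n alpha beta
  * askey_wilson n (qpow l (alpha / 2 + 1 / 4)) (qpow l (alpha / 2 + 3 / 4))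
      (- qpow l (beta / 2 + 1 / 4)) (- qpow l (beta / 2 + 3 / 4)) q x.

End ContinuousQJacobi.

(* Main.v *)
Require Import Defs.
From mathcomp Require Import all_boot all_order all_algebra.
From mathcomp Require Import reals exp trigo ring zify.

(* Write A = q^alpha, B = q^beta, s = q^(1/2), E = AB, p = q^2. The parameters in
   base p are a = As, b = Asq, c = -Bs, d = -Bsq.

   At z = a only the term k = 0 of the defining sum survives. At z = c the factor
   (az;p)_k cancels (ac;p)_k, and the sum is q-Pfaff-Saalschuetz. The values at
   z = s and z = -s are exchanged by changing the signs of A, B and s, so z = s
   remains. There (az, a/z;p)_k = (A;q)_2k, and one needs
     sum_k (A^2 p^(k+1);p)_(n-k) (-E q^(2k+1);q)_(2n-2k) (E^2 p^(n+1), p^(-n);p)_k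
           (A;q)_2k p^k / (p;p)_k
     = (Aq, -q, -E q^(n+1);q)_n prod_(1 <= i <= n) (A + E q^i).
   Both sides are polynomials of degree at most 2n in E. They agree at the following
   2n + 1 points, which are distinct for generic A:
   - E = q^(-n-1), where only k = 0 contributes;
   - E = -q^(-j) for n < j <= 2n, where every summand vanishes;
   - E = -A q^(-i) for 1 <= i <= n, where the sum is a constant times
     sum_k (p^(-n);p)_k / (p;p)_k p^k f(p^k) with f a polynomial of degree n - 1,
     which is 0 by the q-binomial theorem.
   As both sides are also polynomials in A, the identity holds for all A. *)

Set Implicit Arguments.
Unset Strict Implicit.

Import GRing.Theory Num.Theory.
Local Open Scope ring_scope.
Local Open Scope complex_scope.

(** * Rearrangements of q-Pochhammer symbols *)

Section Qpoch.
Variable F : fieldType.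
Implicit Types (a c q x : F) (m n k : nat).

Lemma qpoch0 a q : qpoch a q 0 = 1.
Proof. by rewrite /qpoch big_ord0. Qed.

Lemma qpochSr a q n : qpoch a q n.+1 = qpoch a q n * (1 - a * q ^+ n).
Proof. by rewrite /qpoch big_ord_recr. Qed.

Lemma qpochSl a q n : qpoch a q n.+1 = (1 - a) * qpoch (a * q) q n.
Proof.
rewrite /qpoch big_ord_recl expr0 mulr1; congr (_ * _).
by apply: eq_bigr => i _; rewrite -mulrA -exprS.
Qed.

Lemma qpochD a q m n : qpoch a q (m + n) = qpoch a q m * qpoch (a * q ^+ m) q n.
Proof.
rewrite /qpoch big_split_ord; congr (_ * _).
by apply: eq_bigr => i _ /=; rewrite -mulrA -exprD.
Qed.

Lemma qpoch_root a q n j : (j < n)%N -> a * q ^+ j = 1 -> qpoch a q n = 0.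
Proof.
by move=> jn e; rewrite /qpoch (bigD1 (Ordinal jn)) //= e subrr mul0r.
Qed.

Lemma qpoch_sqr a q n :
  qpoch (a ^+ 2) (q ^+ 2) n = qpoch a q n * qpoch (- a) q n.
Proof.
rewrite /qpoch -big_split /=; apply: eq_bigr => i _.
rewrite -exprM mulnC exprM; move: (q ^+ i) => y; ring.
Qed.

Lemma qpoch_double a q n :
  qpoch a q n.*2 = qpoch a (q ^+ 2) n * qpoch (a * q) (q ^+ 2) n.
Proof.
elim: n => [|n IH]; first by rewrite !qpoch0 mulr1.
rewrite doubleS !qpochSr IH -exprM mul2n [q ^+ n.*2.+1]exprS; move: (q ^+ n.*2) => y; ring.
Qed.

Lemma qpochs2 a1 a2 q n : qpochs [:: a1; a2] q n = qpoch a1 q n * qpoch a2 q n.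
Proof. by rewrite /qpochs !big_cons big_nil mulr1. Qed.

Lemma qpoch_nat a q i m :
  qpoch (a * q ^+ i) q m = \prod_(i <= j < i + m) (1 - a * q ^+ j).
Proof.
have := big_addn 0 (i + m) i xpredT (fun j => 1 - a * q ^+ j).
rewrite add0n addKn => ->; rewrite big_mkord.
by apply: eq_bigr => j _; rewrite -mulrA -exprD addnC.
Qed.

(* The factors with exponents in [i, i + m) and [j, j + l) are rearranged
   into [i, j + l) and [j, i + m). *)
Lemma qpoch_exchange a q i m j l : (i <= j + l)%N -> (j <= i + m)%N ->
  qpoch (a * q ^+ i) q m * qpoch (a * q ^+ j) q l
  = qpoch (a * q ^+ i) q (j + l - i) * qpoch (a * q ^+ j) q (i + m - j).
Proof.
(* The claim is symmetric under exchanging the two ranges. *)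
wlog le : i m j l / (i + m <= j + l)%N => [H il jm|].
  have [/H|/ltnW /H] := leqP (i + m) (j + l); first by apply.
  by move=> /(_ jm il) E; rewrite mulrC E mulrC.
move=> il jm; rewrite !qpoch_nat !subnKC //.
(* The ranges [j, j + l) on the left and [i, j + l) on the right are both cut at i + m. *)
rewrite (big_cat_nat jm le) [in RHS](big_cat_nat (leq_addr m i) le) /=.
by rewrite mulrA mulrAC.
Qed.

Lemma qpoch_neq0 q n : (forall m, (0 < m)%N -> q ^+ m != 1) -> qpoch q q n != 0.
Proof.
move=> hq; apply/prodf_neq0 => i _.
by rewrite -exprS subr_eq0 eq_sym hq.
Qed.

End Qpoch.

(** * Functions given by polynomials of bounded degree *)

Section PolynomialFunctions.
Variable F : fieldType.
Implicit Types (f g : F -> F) (d e : nat).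

(** The degree bound is attached to a function, so that expressions built from [qpoch] are treated
    as polynomials in any chosen variable without being rewritten in [{poly F}]. *)
Definition polyfun d f :=
  exists2 p : {poly F}, (size p <= d.+1)%N & forall x, p.[x] = f x.

Lemma polyfun_ext d f g : polyfun d f -> f =1 g -> polyfun d g.
Proof. by case=> p sp pf fg; exists p => // x; rewrite pf. Qed.

Lemma polyfun_cst d c : polyfun d (fun=> c).
Proof.
exists c%:P => [|x]; last by rewrite hornerC.
exact: leq_trans (size_polyC_leq1 c) _.
Qed.

Lemma polyfun_id : polyfun 1 id.
Proof. by exists 'X => [|x]; rewrite ?size_polyX ?hornerX. Qed.

Lemma polyfunD d f g : polyfun d f -> polyfun d g -> polyfun d (fun x => f x + g x).
Proof.
case=> [p sp pf] [r sr rg]; exists (p + r) => [|x]; last by rewrite hornerD pf rg.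
by apply: leq_trans (size_polyD _ _) _; rewrite geq_max sp.
Qed.

Lemma polyfunM d e f g :
  polyfun d f -> polyfun e g -> polyfun (d + e) (fun x => f x * g x).
Proof.
case=> [p sp pf] [r sr rg]; exists (p * r) => [|x]; last by rewrite hornerM pf rg.
apply: leq_trans (size_polyMleq _ _) _.
by rewrite -ltnS; apply: leq_trans (leqSpred _) _; lia.
Qed.

Lemma polyfun_mulr d f c : polyfun d f -> polyfun d (fun x => f x * c).
Proof. by move=> H; have := polyfunM H (polyfun_cst 0 c); rewrite addn0. Qed.

Lemma polyfun_opp : polyfun 1 (fun x => - x).
Proof. by apply: polyfun_ext (polyfun_mulr (-1) polyfun_id) _ => x; rewrite mulrN1. Qed.

Lemma polyfun_sqr : polyfun 2 (fun x => x ^+ 2).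
Proof. exact: polyfun_ext (polyfunM polyfun_id polyfun_id) _. Qed.

Lemma polyfunB d f g : polyfun d f -> polyfun d g -> polyfun d (fun x => f x - g x).
Proof.
move=> pf pg; apply: polyfunD => //.
by apply: polyfun_ext (polyfun_mulr (-1) pg) _ => x; rewrite mulrN1.
Qed.

Lemma polyfun_sum d n (f : nat -> F -> F) :
  (forall k, (k < n)%N -> polyfun d (f k)) ->
  polyfun d (fun x => \sum_(k < n) f k x).
Proof.
elim: n => [_|n IH H].
  by apply: polyfun_ext (polyfun_cst d 0) _ => x; rewrite big_ord0.
have := polyfunD (IH (fun k kn => H k (ltnW kn))) (H n (leqnn _)).
by move/polyfun_ext; apply=> x; rewrite big_ord_recr.
Qed.

Lemma polyfun_prod d n (f : nat -> F -> F) :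
  (forall k, polyfun d (f k)) -> polyfun (d * n) (fun x => \prod_(k < n) f k x).
Proof.
move=> H; elim: n => [|n IH].
  by apply: polyfun_ext (polyfun_cst _ 1) _ => x; rewrite big_ord0.
apply: (polyfun_ext (f := fun x => (\prod_(k < n) f k x) * f n x)).
  by rewrite mulnS addnC; apply: polyfunM.
by move=> x; rewrite big_ord_recr.
Qed.

Lemma polyfun_qpoch d f q n : polyfun d f -> polyfun (d * n) (fun x => qpoch (f x) q n).
Proof.
move=> H; apply: (@polyfun_prod d n (fun k x => 1 - f x * q ^+ k)) => k.
apply: polyfunB; first exact: polyfun_cst.
exact: polyfun_mulr.
Qed.

Lemma polyfun_eq0 d f (s : seq F) : polyfun d f -> uniq s -> (d < size s)%N ->
  (forall x, x \in s -> f x = 0) -> forall x, f x = 0.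
Proof.
case=> p sp pf us ds fs x; rewrite -pf.
suff -> : p = 0 by rewrite horner0.
apply: roots_geq_poly_eq0 us (leq_trans sp ds).
by apply/allP => y ys; apply/rootP; rewrite pf fs.
Qed.

End PolynomialFunctions.

(** * Terminating q-series for q not a root of unity *)

Section QSeries.
Variables (F : fieldType) (q : F).
Hypotheses (q0 : q != 0) (hq : forall m, (0 < m)%N -> q ^+ m != 1).

Lemma expf_inj : injective (fun m : nat => q ^+ m).
Proof.
have H i j : q ^+ i = q ^+ j -> (i <= j)%N -> i = j.
  move=> e; rewrite leq_eqVlt => /orP[/eqP //|ij].
  have /hq/eqP[] : (0 < j - i)%N by rewrite subn_gt0.
  by apply: (mulfI (expf_neq0 i q0)); rewrite -exprD subnKC 1?ltnW // e mulr1.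
move=> i j e; have [|/ltnW] := leqP i j; first exact: H.
by move/(H j i (esym e)).
Qed.

(** Multiplying by the product of X - y over y in [s] gives a polynomial that vanishes everywhere,
    in particular at the powers of q. These are infinitely many, so the product is 0. *)
Lemma polyfun_generic_eq0 d f (s : seq F) : polyfun d f ->
  (forall x, x \notin s -> f x = 0) -> forall x, f x = 0.
Proof.
case=> p sp pf H x; rewrite -pf; suff -> : p = 0 by rewrite horner0.
pose r := \prod_(y <- s) ('X - y%:P).
have r0 : r != 0 by apply: monic_neq0; apply: monic_prod_XsubC.
suff /eqP : p * r = 0 by rewrite mulf_eq0 (negPf r0) orbF => /eqP.
pose t := [seq q ^+ m | m <- iota 0 (size (p * r))].
apply: (@roots_geq_poly_eq0 _ _ t).
- apply/allP => y _; rewrite rootM; have [ys|/H ys] := boolP (y \in s).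
    by rewrite [root r y]root_prod_XsubC ys orbT.
  by rewrite /root pf ys eqxx.
- by rewrite map_inj_uniq ?iota_uniq //; apply: expf_inj.
- by rewrite size_map size_iota.
Qed.

(** Induction on n: the partial sums up to m for n + 1 and for n differ by the factor 1 - y/q^(n+1)
    and a boundary term, which vanishes at m = n + 1. *)
Lemma qbinomial_thm n y :
  \sum_(k < n.+1) qpoch (q ^- n) q k / qpoch q q k * y ^+ k = qpoch (y / q ^+ n) q n.
Proof.
elim: n => [|n IH]; first by rewrite big_ord1 !qpoch0 expr0 mulr1 divr1.
pose t n k := qpoch (q ^- n) q k / qpoch q q k * y ^+ k.
have H m : \sum_(k < m.+1) t n.+1 k
    = (1 - y / q ^+ n.+1) * (\sum_(k < m.+1) t n k) + y / q ^+ n.+1 * t n m.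
  elim: m => [|m IHm]; first by rewrite !big_ord1 /t !qpoch0; ring.
  rewrite big_ord_recr /= IHm [in RHS]big_ord_recr /= mulrDr -!addrA; congr (_ + _).
  rewrite /t qpochSl !qpochSr.
  have -> : q ^- n.+1 * q = q ^- n by rewrite exprS; field; rewrite q0 expf_neq0.
  have := hq (ltn0Sn m); rewrite eq_sym -subr_eq0 !exprS => h1.
  field; rewrite ?h1 ?q0 ?expf_neq0 ?qpoch_neq0 //.
have tn : t n n.+1 = 0.
  by rewrite /t (@qpoch_root _ _ _ _ n) ?mul0r // mulVf // expf_neq0.
rewrite -/(t _ _) H big_ord_recr /= tn mulr0 !addr0 /t IH qpochSl.
by congr (_ * qpoch _ _ _); rewrite exprS; field; rewrite q0 expf_neq0.
Qed.

(** By linearity f may be taken as X^i with i < n. The q-binomial theorem at y = q^(i+1) then gives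
    (q^(i+1-n);q)_n, whose factor of index n - i - 1 is zero. *)
Lemma orthogonality n d f : polyfun d f -> (d < n)%N ->
  \sum_(k < n.+1) qpoch (q ^- n) q k / qpoch q q k * q ^+ k * f (q ^+ k) = 0.
Proof.
case=> p sp pf dn.
under eq_bigr => k _ do rewrite -pf horner_coef mulr_sumr.
rewrite exchange_big /= big1 // => i _.
rewrite (eq_bigr (fun k : 'I_n.+1 =>
  qpoch (q ^- n) q k / qpoch q q k * (q ^+ i.+1) ^+ k * p`_i)); last first.
  by move=> k _; rewrite (exprAC q i.+1 k) exprS -!mulrA;
     congr (_ * (_ * (_ * _))); rewrite mulrC.
have ni : (i < n)%N by apply: leq_trans dn; apply: leq_trans (ltn_ord i) sp.
rewrite -mulr_suml qbinomial_thm (@qpoch_root _ _ _ _ (n - i.+1)) ?mul0r //.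
  by rewrite ltn_subrL /=; apply: leq_trans ni.
by rewrite mulrAC -exprD subnKC // mulfV // expf_neq0.
Qed.

(* The q-Pfaff-Saalschuetz sum with denominators cleared. Summing to n + 1
   satisfies a first-order recurrence in n, with telescoping certificate g. *)
Lemma saalschutz n x w b u : x * w = b * u ->
  \sum_(k < n.+1) qpoch (x * q ^+ k) q (n - k) * qpoch w q^-1 (n - k)
     * (qpoch (q ^- n) q k * qpoch b q k * qpoch u q k / qpoch q q k) * q ^+ k
  = \prod_(i < n) (b + u - w / q ^+ i - x * q ^+ i).
Proof.
move=> xw; elim: n => [|n IH].
  by rewrite big_ord1 big_ord0 subnn !qpoch0 expr0 invr1 !mulr1.
pose t n k := qpoch (x * q ^+ k) q (n - k) * qpoch w q^-1 (n - k)
     * (qpoch (q ^- n) q k * qpoch b q k * qpoch u q k / qpoch q q k) * q ^+ k.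
pose g k := qpoch (q ^- n) q k * qpoch b q k.+1 * qpoch u q k.+1
  * (qpoch (x * q ^+ k) q (n - k) * qpoch w q^-1 (n - k)) / qpoch q q k.
pose r := b + u - w / q ^+ n - x * q ^+ n.
have q1 k : 1 - q * q ^+ k != 0 by rewrite subr_eq0 -exprS eq_sym hq.
have qS k : q ^- k.+1 * q = q ^- k by rewrite exprS; field; rewrite q0 expf_neq0.
(* The range stops at m = n, beyond which the truncated difference n - m would spoil the
   recurrence. *)
have H m : (m <= n)%N ->
    \sum_(k < m.+1) t n.+1 k = r * (\sum_(k < m.+1) t n k) + g m.
  elim: m => [_|m IHm mn].
    rewrite !big_ord1 /t /g !subn0 !qpochSr !qpoch0 !expr0 exprVn /r.
    apply/eqP; rewrite -subr_eq0; apply/eqP.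
    rewrite [LHS](_ : _ = qpoch (x * 1) q n * qpoch w q^-1 n * (x * w - b * u)).
      by rewrite xw subrr mulr0.
    by field; rewrite ?expf_neq0 ?oner_eq0.
  rewrite big_ord_recr /= IHm 1?ltnW // [in RHS]big_ord_recr /= mulrDr -!addrA.
  congr (_ + _); rewrite /t /g /r.
  have [l nE] : exists l, n = (m.+1 + l)%N by exists (n - m.+1)%N; rewrite subnKC.
  have -> : (n - m = l.+1)%N by lia.
  have -> : (n.+1 - m.+1 = l.+1)%N by lia.
  have -> : (n - m.+1 = l)%N by lia.
  rewrite (qpochSl (x * q ^+ m)) -(mulrA x) -exprSr (qpochSr (x * q ^+ m.+1)).
  rewrite (qpochSr w) (qpochSl (q ^- n.+1)) qS (qpochSr (q ^- n)) (qpochSr q).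
  rewrite !(qpochSr _ _ m.+1) nE !exprS !exprD exprVn.
  apply/eqP; rewrite -subr_eq0; apply/eqP.
  set h1 := qpoch _ q m; set h2 := qpoch b q _; set h3 := qpoch u q _.
  set h4 := qpoch _ q l; set h5 := qpoch w _ l; set h6 := qpoch q q m.
  (* The two sides differ by a multiple of x w - b u, which the balancing condition makes zero. *)
  rewrite [LHS](_ : _ = h1 * h2 * h3 * h4 * h5 / (h6 * (1 - q * q ^+ m))
    * (q * q ^+ m) ^+ 2 * (1 - (q * q ^+ l)^-1) * (x * w - b * u)).
    by rewrite xw subrr mulr0.
  by field; rewrite q1 q0 !expf_neq0 // qpoch_neq0.
rewrite big_ord_recr [in RHS]big_ord_recr /= -IH -/(t _ _) H //= mulrC.
(* The remaining summand, k = n + 1, is the opposite of [g n]. *)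
rewrite -addrA [X in _ + X](_ : _ = 0) ?addr0 1?mulrC //.
rewrite /t /g !subnn !qpoch0 (qpochSl (q ^- n.+1)) qS (qpochSr q).
have := q1 n; rewrite !exprS => h.
by field; rewrite h q0 !expf_neq0 // qpoch_neq0.
Qed.

End QSeries.

(** * The quadratic summation behind the value at z = s *)

Section QuadraticSum.
Variables (F : fieldType) (q : F).
Hypotheses (q0 : q != 0) (hq : forall m, (0 < m)%N -> q ^+ m != 1) (two0 : 2 != 0 :> F).

Local Notation p := (q ^+ 2).

Let p0 : p != 0. Proof. exact: expf_neq0. Qed.
Let hp m : (0 < m)%N -> p ^+ m != 1.
Proof. by move=> m0; rewrite -exprM hq // muln_gt0. Qed.

Definition quad_term n A E k :=
  qpoch (A ^+ 2 * p ^+ k.+1) p (n - k) * qpoch (- E * q ^+ k.*2.+1) q (n - k).*2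
  * qpoch (E ^+ 2 * p ^+ n.+1) p k * qpoch A q k.*2
  * (qpoch (p ^- n) p k / qpoch p p k * p ^+ k).

Definition quad_sum n A E := \sum_(k < n.+1) quad_term n A E k.

Definition quad_prod n A E :=
  qpoch (A * q) q n * qpoch (- q) q n * qpoch (- E * q ^+ n.+1) q n
  * \prod_(i < n) (A + E * q ^+ i.+1).

(** In the summand the degrees in E are 2(n - k) and 2k; in the product the last two factors
    contribute n each. *)
Lemma quad_polyE n A : polyfun n.*2 (fun E => quad_sum n A E - quad_prod n A E).
Proof.
apply: polyfunB.
  apply: (@polyfun_sum _ _ _ (fun k E => quad_term n A E k)) => k kn.
  apply: polyfun_mulr; apply: polyfun_mulr.
  have -> : (n.*2 = 0 + 1 * (n - k).*2 + 2 * k)%N by lia.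
  apply: polyfunM; first apply: polyfunM; first exact: polyfun_cst.
    by apply: polyfun_qpoch; apply: polyfun_mulr; exact: polyfun_opp.
  by apply: polyfun_qpoch; apply: polyfun_mulr; exact: polyfun_sqr.
have -> : (n.*2 = 0 + 1 * n + 1 * n)%N by lia.
apply: polyfunM; first apply: polyfunM; first exact: polyfun_cst.
  by apply: polyfun_qpoch; apply: polyfun_mulr; exact: polyfun_opp.
apply: (@polyfun_prod _ _ _ (fun i E => A + E * q ^+ i.+1)) => i.
by apply: polyfunD; [exact: polyfun_cst|apply: polyfun_mulr; exact: polyfun_id].
Qed.

(** The degrees in A are 2(n - k) and 2k in the summand. This serves to pass from generic A to all
    A. *)
Lemma quad_polyA n E : polyfun n.*2 (fun A => quad_sum n A E - quad_prod n A E).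
Proof.
apply: polyfunB.
  apply: (@polyfun_sum _ _ _ (fun k A => quad_term n A E k)) => k kn.
  apply: polyfun_mulr.
  have -> : (n.*2 = 2 * (n - k) + 1 * k.*2)%N by lia.
  apply: polyfunM; first do 2 apply: polyfun_mulr.
    by apply: polyfun_qpoch; apply: polyfun_mulr; exact: polyfun_sqr.
  by apply: polyfun_qpoch; exact: polyfun_id.
have -> : (n.*2 = 1 * n + 1 * n)%N by lia.
apply: polyfunM; first do 2 apply: polyfun_mulr.
  by apply: polyfun_qpoch; apply: polyfun_mulr; exact: polyfun_id.
apply: (@polyfun_prod _ _ _ (fun i A => A + E * q ^+ i.+1)) => i.
by apply: polyfunD; [exact: polyfun_id|exact: polyfun_cst].
Qed.

(* The summands with k > 0 vanish at this point. *)
Lemma quad_single n A : quad_sum n A (q ^- n.+1) = quad_prod n A (q ^- n.+1).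
Proof.
have e1 : q ^- n.+1 ^+ 2 * p ^+ n.+1 = 1.
  by rewrite exprVn -!exprM mulnC mulVf ?expf_neq0.
rewrite /quad_sum /quad_term e1 big_ord_recl big1 => [|k _]; last first.
  by rewrite (@qpoch_root _ 1 _ _ 0) ?mulr1 // mulr0 !mul0r.
rewrite !qpoch0 subn0 addr0 expr0 !mulr1 invr1 mulr1 -exprMn qpoch_sqr.
rewrite double0 expr1 /quad_prod -!mulrA; congr (_ * _).
have e2' : q ^- n.+1 * q = q ^- n by rewrite exprS; field; rewrite q0 expf_neq0.
have e2 : - q ^- n.+1 * q = - q ^- n by rewrite mulNr e2'.
have e3 : - q ^- n * q ^+ n = -1 by rewrite mulNr mulVf ?expf_neq0.
have e4 : - q ^- n.+1 * q ^+ n.+1 = -1 by rewrite mulNr mulVf ?expf_neq0.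
rewrite e2 -addnn qpochD e3 e4.
have revE (i : 'I_n) : q ^- n * q ^+ (n - i.+1) = q ^- i.+1.
  by rewrite -[in q ^- n](subnKC (ltn_ord i)) exprD; field; rewrite !expf_neq0.
(* Reversing the order of factors pulls this same constant out of one product on each side. *)
pose c := \prod_(i < n) q ^- i.+1.
have -> : qpoch (- q ^- n) q n = c * qpoch (- q) q n.
  rewrite /qpoch (reindex_inj rev_ord_inj) -big_split /=; apply: eq_bigr => i _.
  by rewrite !mulNr revE exprS; field; rewrite q0 expf_neq0.
have -> : \prod_(i < n) (A + q ^- n.+1 * q ^+ i.+1) = c * qpoch (- (A * q)) q n.
  rewrite /qpoch (reindex_inj rev_ord_inj) -big_split /=; apply: eq_bigr => i _.
  rewrite (exprS q (n - _)) [q ^- n.+1 * _]mulrA e2'.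
  by rewrite revE exprS; field; rewrite q0 expf_neq0.
by ring.
Qed.

(** At E = -q^(-j) both 1 + E q^j and 1 - E^2 p^j vanish. The k-th summand contains the second if j
    <= 2k and the first if j > 2k; the product contains the first. *)
Lemma quad_vanish n A j : (n < j <= n.*2)%N ->
  quad_sum n A (- q ^- j) = 0 /\ quad_prod n A (- q ^- j) = 0.
Proof.
move=> /andP[nj jn]; rewrite /quad_prod /quad_sum /quad_term !opprK; split; last first.
  rewrite [qpoch (_ * q ^+ n.+1) q n](@qpoch_root _ _ _ _ (j - n.+1)) ?mulr0 ?mul0r //.
    by lia.
  by rewrite -mulrA -exprD subnKC // mulVf ?expf_neq0.
apply: big1 => k _; have [jk|kj] := leqP j k.*2.
  rewrite [qpoch (_ * p ^+ n.+1) p k](@qpoch_root _ _ _ _ (j - n.+1)) ?mulr0 ?mul0r //.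
    by lia.
  by rewrite -mulrA -exprD subnKC // sqrrN exprVn exprAC mulVf ?expf_neq0.
rewrite [qpoch (_ * q ^+ k.*2.+1) q _](@qpoch_root _ _ _ _ (j - k.*2.+1)) ?mulr0 ?mul0r //.
  by lia.
by rewrite -mulrA -exprD subnKC // mulVf ?expf_neq0.
Qed.

(* Here the Pochhammer symbols depending on k merge into a polynomial in p^k of
   degree n - 1, so that orthogonality applies. *)
Lemma quad_orthogonal n A i : (0 < i <= n)%N ->
  quad_sum n A (- A / q ^+ i) = 0 /\ quad_prod n A (- A / q ^+ i) = 0.
Proof.
case/andP; case: i => // i _ ni; rewrite /quad_prod /quad_sum /quad_term; split; last first.
  rewrite (bigD1 (Ordinal ni)) //= mulfVK ?expf_neq0 // addrN.
  by rewrite mul0r mulr0.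
pose a := A / q ^+ i.
(* After the exchange of ranges, [c] holds the ranges of exponents [n-i, n+1) and [i, 2n), free of
   k, and [f] the ranges that start at k+1 and 2k, of fixed lengths n-i-1 and i. The index i has
   been lowered by one. *)
pose f X := qpoch (A ^+ 2 * p * X) p (n - i.+1) * qpoch (a * X) q i.
pose c := qpoch (A ^+ 2 * p ^+ (n - i)) p i.+1 * qpoch (a * q ^+ i) q (n.*2 - i).
rewrite (eq_bigr (fun k : 'I_n.+1 =>
  c * (qpoch (p ^- n) p k / qpoch p p k * p ^+ k * f (p ^+ k)))); last first.
  move=> k _; rewrite mulrC [RHS]mulrCA; congr (_ * _).
  have kn : (k <= n)%N by rewrite -ltnS.
  have -> : - (- A / q ^+ i.+1) * q ^+ k.*2.+1 = a * q ^+ k.*2.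
    by rewrite /a !exprS; field; rewrite q0 expf_neq0.
  have -> : (- A / q ^+ i.+1) ^+ 2 * p ^+ n.+1 = A ^+ 2 * p ^+ (n - i).
    have -> : n.+1 = (n - i + i.+1)%N by lia.
    rewrite exprD expr_div_n sqrrN (exprAC q i.+1); field.
    by rewrite !expf_neq0.
  rewrite -[in qpoch A q _](mulfVK (expf_neq0 i q0) A) -/a -mulrA mulrACA.
  rewrite (@qpoch_exchange _ (A ^+ 2)); [|lia|lia].
  rewrite (@qpoch_exchange _ a); [|lia|lia].
  have -> : (n - i + k - k.+1 = n - i.+1)%N by lia.
  have -> : (k.+1 + (n - k) - (n - i) = i.+1)%N by lia.
  have -> : (i + k.*2 - k.*2 = i)%N by lia.
  have -> : (k.*2 + (n - k).*2 - i = n.*2 - i)%N by lia.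
  rewrite /c /f -(mulrA (A ^+ 2)) -exprS [a * p ^+ k](_ : _ = a * q ^+ k.*2).
    by rewrite mulrACA mulrC.
  by rewrite -exprM mul2n.
rewrite -mulr_sumr (orthogonality p0 hp (d := n.-1)) ?mulr0 //; last by lia.
have -> : (n.-1 = 1 * (n - i.+1) + 1 * i)%N by lia.
by apply: polyfunM; apply: polyfun_qpoch;
  apply: polyfun_ext (polyfun_mulr _ (polyfun_id F)) _ => x; rewrite mulrC.
Qed.

Definition quad_points n A := q ^- n.+1 :: [seq - q ^- j | j <- iota n.+1 n]
  ++ [seq - A / q ^+ i | i <- iota 1 n].

(* Outside these values of A the 2 n + 1 interpolation points are distinct. *)
Definition quad_exceptional n :=
  [seq q ^+ i / q ^+ j | i <- iota 0 n.+1, j <- iota 0 n.*2.+1]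
  ++ [:: 0] ++ [seq - q ^+ i / q ^+ n.+1 | i <- iota 0 n.+1].

(** Points of different families coincide only if A = -q^i/q^(n+1), A = q^i/q^j or q^(j-n-1) = -1.
    The first two are exceptional; the third fails since q is not a root of unity and 2 is nonzero.
    Within the last family, A != 0 separates the points. *)
Lemma uniq_points n A : A \notin quad_exceptional n -> uniq (quad_points n A).
Proof.
rewrite mem_cat (mem_cat _ [:: 0]) mem_seq1 2!negb_or => /and3P[A1 A0 A2].
have Vinj : injective (fun j => q ^- j) by move=> i j /invr_inj; exact: expf_inj.
rewrite cons_uniq mem_cat negb_or cat_uniq; apply/and4P; split.
- apply/andP; split; apply/mapP => -[j]; rewrite mem_iota.
    move=> /andP[nj _] e.
    have {}e : q ^+ (j - n.+1) = -1.
      rewrite -(mulKf (expf_neq0 n.+1 q0) (q ^+ _)) -exprD subnKC // e.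
      by rewrite mulNr mulVf ?expf_neq0.
    have [j0|j0] := posnP (j - n.+1)%N.
      move: e; rewrite j0 => /eqP; rewrite -addr_eq0 expr0 => h.
      by move/eqP: two0; apply; apply/eqP.
    have := @hq ((j - n.+1) * 2) _; rewrite exprM e sqrrN expr1n eqxx.
    by move=> H; have := H ltac:(lia).
  move=> ij e; case/negP: A2; apply/mapP; exists j; first by rewrite mem_iota; lia.
  by rewrite mulNr -mulrN mulrC e; field; rewrite expf_neq0.
- by rewrite map_inj_uniq ?iota_uniq // => i j /oppr_inj /Vinj.
- apply/hasPn => _ /mapP[i ij ->]; apply/mapP => -[j jn e].
  rewrite !mem_iota in ij jn.
  case/negP: A1; apply/allpairsP; exists (i, j).
  split; [by rewrite mem_iota /=; lia|by rewrite mem_iota /=; lia|rewrite /=].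
  move: e; rewrite mulNr => /oppr_inj e.
  by rewrite -e mulrC mulfVK ?expf_neq0.
- rewrite map_inj_uniq ?iota_uniq // => i j /=.
  by rewrite !mulNr => /oppr_inj /(mulfI A0) /Vinj.
Qed.

Lemma quadratic_sum n A E : quad_sum n A E = quad_prod n A E.
Proof.
apply/eqP; rewrite -subr_eq0; apply/eqP.
(* First A is made generic; then 2n + 1 zeros in E exceed the degree 2n. *)
apply: (polyfun_generic_eq0 q0 hq (s := quad_exceptional n) (quad_polyA n E)) => {}A As.
apply: (polyfun_eq0 (quad_polyE n A) (uniq_points As)).
  by rewrite /= size_cat !size_map !size_iota addnn.
move=> {}E; rewrite inE mem_cat => /or3P[/eqP->|/mapP[j ij ->]|/mapP[i ij ->]].
- by rewrite quad_single subrr.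
- have [|-> ->] := @quad_vanish n A j; last by rewrite subrr.
  by move: ij; rewrite mem_iota; lia.
- have [|-> ->] := @quad_orthogonal n A i; last by rewrite subrr.
  by move: ij; rewrite mem_iota; lia.
Qed.

End QuadraticSum.

(** * Askey-Wilson sums at z = a, z = c and z = s *)

Section AskeyWilsonValues.
Variable F : numClosedFieldType.
Implicit Types (a b c d q A B s : F).

(** Reversal makes the first argument of (ad q^k;q)_(n-k) independent of k, as [saalschutz]
    requires. *)
Lemma qpoch_rev a q n : q != 0 -> qpoch a q n = qpoch (a * q ^+ n / q) q^-1 n.
Proof.
move=> q0; rewrite /qpoch (reindex_inj rev_ord_inj) /=; apply: eq_bigr => i _.
congr (1 - _); rewrite -!mulrA; congr (_ * _).
have -> : q ^+ n = q ^+ (n - i.+1) * q ^+ i.+1 by rewrite -exprD subnK.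
rewrite exprS exprVn.
by field; rewrite q0 expf_neq0.
Qed.

Lemma qpochs3 a b c q n :
  qpochs [:: a; b; c] q n = qpoch a q n * qpoch b q n * qpoch c q n.
Proof. by rewrite /qpochs !big_cons big_nil mulr1 !mulrA. Qed.

Lemma qpochs4 a b c d q n : qpochs [:: a; b; c; d] q n
  = qpoch a q n * qpoch b q n * qpoch c q n * qpoch d q n.
Proof. by rewrite /qpochs !big_cons big_nil mulr1 !mulrA. Qed.

Lemma expz_pred q n : q != 0 -> q ^ (n%:Z - 1) = q ^+ n / q.
Proof. by move=> q0; rewrite expfzDr // exprN1. Qed.

Lemma askey_wilson_z_first n a b c d q : a != 0 ->
  askey_wilson_z n a b c d q a = a ^- n * qpochs [:: a * b; a * c; a * d] q n.
Proof.
move=> a0; congr (_ * _); rewrite big_ord_recl big1 => [|k _].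
  by rewrite addr0 subn0 qpochs4 !qpoch0 !expr0 invr1 !mulr1.
rewrite qpochs4 (@qpoch_root _ (a / a) q _ 0) //; first by rewrite mulr0 mul0r mulr0 mul0r.
by rewrite mulr1 divff.
Qed.

Lemma askey_wilson_z_third n a b c d q :
  q != 0 -> (forall m, (0 < m)%N -> q ^+ m != 1) -> a != 0 -> c != 0 ->
  askey_wilson_z n a b c d q c = c ^- n * qpochs [:: a * c; b * c; c * d] q n.
Proof.
move=> q0 hq a0 c0.
pose x := a * b; pose w := a * d * q ^+ n / q.
pose e := q ^ (n%:Z - 1) * (a * b * c * d); pose u := a / c.
have xw : x * w = e * u by rewrite /x /w /e /u expz_pred //; field; rewrite q0 c0.
rewrite /askey_wilson_z (eq_bigr (fun k : 'I_n.+1 => qpoch (a * c) q n *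
  (qpoch (x * q ^+ k) q (n - k) * qpoch w q^-1 (n - k)
     * (qpoch (q ^- n) q k * qpoch e q k * qpoch u q k / qpoch q q k) * q ^+ k))); last first.
  move=> k _; have kn : (k <= n)%N by rewrite -ltnS.
  rewrite qpochs3 qpochs4 (qpoch_rev (a * d * q ^+ k)) // -(mulrA (a * d)) -exprD.
  rewrite subnKC // -[in qpoch _ _ n](subnKC kn) qpochD -/w -/x -/e -/u; ring.
rewrite -mulr_sumr saalschutz // qpochs3.
(* Each factor is u (1 - bc q^i)(1 - cd q^(n-1-i)), so the symbol in cd appears in reversed
   order. *)
rewrite (_ : \prod_(i < n) _ = u ^+ n * (qpoch (b * c) q n * qpoch (c * d) q n)).
  by rewrite /u expr_div_n; field; rewrite !expf_neq0.
rewrite [qpoch (c * d) q n]qpoch_rev // /qpoch -big_split /=.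
rewrite -[n in u ^+ n]card_ord -prodr_const -big_split /=; apply: eq_bigr => i _.
rewrite /u /w /x /e expz_pred // exprVn.
by field; rewrite q0 c0 expf_neq0.
Qed.

Lemma askey_wilson_z_quadratic n q A B s :
  q != 0 -> (forall m, (0 < m)%N -> q ^+ m != 1) -> s ^+ 2 = q ->
  askey_wilson_z n (A * s) (A * s * q) (- (B * s)) (- (B * s * q)) (q ^+ 2) s
  = (A * s) ^- n * A ^+ n
    * qpochs [:: A * q; - q; - (A * B) * q ^+ n.+1; - (B * q)] q n.
Proof.
move=> q0 hq sq; rewrite -[RHS]mulrA; congr (_ * _).
have s0 : s != 0 by apply: contraNneq q0 => s0; rewrite -sq s0 expr0n.
pose E := A * B.
transitivity (quad_sum q n A E).
  apply: eq_bigr => k _; rewrite /quad_term qpochs3 qpochs4.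
  have -> : A * s * (A * s * q) * q ^+ 2 ^+ k = A ^+ 2 * q ^+ 2 ^+ k.+1.
    by rewrite [q ^+ 2 ^+ k.+1]exprS; move: (q ^+ 2 ^+ k) => y; rewrite -sq; ring.
  have -> : (q ^+ 2) ^ (n%:Z - 1) * (A * s * (A * s * q) * - (B * s) * - (B * s * q))
     = E ^+ 2 * q ^+ 2 ^+ n.+1.
    rewrite expz_pred ?expf_neq0 // [q ^+ 2 ^+ n.+1]exprS /E -sq.
    by move: (s ^+ 2 ^+ 2 ^+ n) => y; field.
  have -> : A * s * s = A * q by rewrite -sq; ring.
  (* Splitting the symbols of even length by parity of the exponent gives those in az, a/z and in
     ac, ad, to base q^2. *)
  rewrite (mulfK s0) !qpoch_double.
  have qk : q ^+ k.*2 = q ^+ 2 ^+ k by rewrite -exprM mul2n.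
  have -> : A * s * - (B * s) * q ^+ 2 ^+ k = - E * q ^+ k.*2.+1.
    by rewrite [q ^+ k.*2.+1]exprS qk /E; move: (q ^+ 2 ^+ k) => y; rewrite -sq; ring.
  have -> : A * s * - (B * s * q) * q ^+ 2 ^+ k = - E * q ^+ k.*2.+1 * q.
    by rewrite [q ^+ k.*2.+1]exprS qk /E; move: (q ^+ 2 ^+ k) => y; rewrite -sq; ring.
  ring.
rewrite quadratic_sum ?pnatr_eq0 // /quad_prod qpochs4.
rewrite (_ : \prod_(i < n) _ = A ^+ n * qpoch (- (B * q)) q n); first by rewrite /E; ring.
rewrite /qpoch -[n in A ^+ n]card_ord -prodr_const -big_split /=.
by apply: eq_bigr => i _; rewrite /E exprS; ring.
Qed.

End AskeyWilsonValues.

(** * The four values with the complex powers as free parameters *)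

(* A, B, s stand for q^alpha, q^beta, q^(1/2). *)
Section JacobiValues.
Variables (F : numClosedFieldType) (n : nat) (q A B s : F).
Hypotheses (q0 : q != 0) (hq : forall m, (0 < m)%N -> q ^+ m != 1).
Hypotheses (sq : s ^+ 2 = q) (A0 : A != 0) (B0 : B != 0).

Local Notation den := (qpochs [:: q; - q; - (A * B * q); - (A * B) * q ^+ n.+1] q n).

Hypothesis den0 : den != 0.

Local Notation value z := ((A * s) ^+ n / den
  * askey_wilson_z n (A * s) (A * s * q) (- (B * s)) (- (B * s * q)) (q ^+ 2) z).

Let s0 : s != 0. Proof. by apply: contraNneq q0 => s0; rewrite -sq s0 expr0n. Qed.

Let As0 : A * s != 0. Proof. exact: mulf_neq0. Qed.

Let Bs0 : B * s != 0. Proof. exact: mulf_neq0. Qed.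

Let den_factors : [/\ qpoch q q n != 0, qpoch (- q) q n != 0,
  qpoch (- (A * B * q)) q n != 0 & qpoch (- (A * B) * q ^+ n.+1) q n != 0].
Proof.
by move: den0; rewrite qpochs4 !mulf_eq0 !negb_or
  => /andP[/andP[/andP[-> ->] ->] ->].
Qed.

Let pairE : qpoch (- (A * B * q)) (q ^+ 2) n * qpoch (- (A * B * q) * q) (q ^+ 2) n
  = qpoch (- (A * B * q)) q n * qpoch (- (A * B) * q ^+ n.+1) q n.
Proof.
rewrite -qpoch_double -addnn qpochD; congr (_ * qpoch _ _ _).
by rewrite exprS; ring.
Qed.

Let ac : A * s * - (B * s) = - (A * B * q). Proof. by rewrite -sq; ring. Qed.

Lemma jacobi_value1 : value s
  = A ^+ n * (qpochs [:: A * q; - (B * q)] q n / qpochs [:: q; - (A * B * q)] q n).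
Proof.
have [d1 d2 d3 d4] := den_factors.
rewrite askey_wilson_z_quadratic // !qpochs4 !qpochs2.
by field; rewrite d1 d2 d3 d4 !expf_neq0.
Qed.

Lemma jacobi_value2 : value (- s)
  = (- A) ^+ n * (qpochs [:: - (A * q); B * q] q n / qpochs [:: q; - (A * B * q)] q n).
Proof.
have [d1 d2 d3 d4] := den_factors.
(* Changing the signs of A, B and s preserves As, Bs, AB and s^2, hence all parameters, and turns
   the value at s into the one at -s. *)
have -> : A * s = - A * - s by rewrite mulrNN.
have -> : B * s = - B * - s by rewrite mulrNN.
rewrite askey_wilson_z_quadratic ?sqrrN // !qpochs4 !qpochs2.
rewrite [- A * - B]mulrNN (mulNr A q) (mulNr B q) opprK.
by field; rewrite d1 d2 d3 d4 mulrNN !expf_neq0.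
Qed.

Lemma jacobi_value3 : value (A * s)
  = qpochs [:: A * q; - (A * q)] q n / qpochs [:: q; - q] q n.
Proof.
have [d1 d2 d3 d4] := den_factors.
rewrite askey_wilson_z_first // qpochs3 qpochs4 !qpochs2 ac.
have -> : A * s * - (B * s * q) = - (A * B * q) * q by rewrite -sq; ring.
have -> : A * s * (A * s * q) = (A * q) ^+ 2 by rewrite -sq; ring.
rewrite -[_ * qpoch (- (A * B * q) * q) _ _]mulrA pairE qpoch_sqr.
by field; rewrite d1 d2 d3 d4 !expf_neq0.
Qed.

Lemma jacobi_value4 : value (- (B * s))
  = (- (A / B)) ^+ n * (qpochs [:: B * q; - (B * q)] q n / qpochs [:: q; - q] q n).
Proof.
have [d1 d2 d3 d4] := den_factors.
have hp m : (0 < m)%N -> (q ^+ 2) ^+ m != 1.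
  by move=> m0; rewrite -exprM hq // muln_gt0.
rewrite askey_wilson_z_third ?oppr_eq0 ?expf_neq0 // qpochs3 qpochs4 !qpochs2 ac.
have -> : A * s * q * - (B * s) = - (A * B * q) * q by rewrite -sq; ring.
have -> : - (B * s) * - (B * s * q) = (B * q) ^+ 2 by rewrite -sq; ring.
have -> : (- (A / B)) ^+ n = (A * s) ^+ n * (- (B * s)) ^- n.
  by rewrite -exprVn -exprMn; congr (_ ^+ n); field; rewrite B0 s0.
rewrite pairE qpoch_sqr.
by field; rewrite d1 d2 d3 d4 expf_neq0 ?oppr_eq0.
Qed.

End JacobiValues.

(** * Complex powers of q *)

Section ComplexPowers.
Variable R : realType.
Implicit Types (z w l s t : R[i]).

Lemma cexpD z w : cexp (z + w) = cexp z * cexp w.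
Proof.
case: z => a b; case: w => c d; rewrite /cexp /=.
rewrite expRD cosD sinD; simpc; congr (_ +i* _); ring.
Qed.

Lemma cexp0 : cexp (0 : R[i]) = 1.
Proof. by rewrite /cexp /= expR0 cos0 sin0 mul1r. Qed.

Lemma qpowD l s t : qpow l (s + t) = qpow l s * qpow l t.
Proof. by rewrite /qpow mulrDl cexpD. Qed.

Lemma qpow0 l : qpow l 0 = 1.
Proof. by rewrite /qpow mul0r cexp0. Qed.

Lemma qpow_mulN l s : qpow l s * qpow l (- s) = 1.
Proof. by rewrite -qpowD subrr qpow0. Qed.

Lemma qpow_neq0 l s : qpow l s != 0.
Proof.
apply/eqP => e; have := qpow_mulN l s; rewrite e mul0r => /eqP.
by rewrite eq_sym oner_eq0.
Qed.

Lemma qpowN l s : qpow l (- s) = (qpow l s)^-1.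
Proof. by apply: (mulfI (qpow_neq0 l s)); rewrite qpow_mulN divff // qpow_neq0. Qed.

Lemma qpowMn l s n : qpow l (s * n%:R) = qpow l s ^+ n.
Proof.
elim: n => [|n IH]; first by rewrite mulr0 qpow0.
by rewrite -natr1 mulrDr mulr1 qpowD IH exprSr.
Qed.

(** This is the convention (q^2)^s = q^(2s): the base q^2 comes with the logarithm 2 log q. *)
Lemma qpow_scale l s : qpow (2 * l) s = qpow l (2 * s).
Proof. by rewrite /qpow mulrCA mulrA. Qed.

End ComplexPowers.

Lemma expf_neq1_norm (F : numDomainType) (q : F) m :
  `|q| != 1 -> (0 < m)%N -> q ^+ m != 1.
Proof.
move=> nq m0; apply: contra nq => /eqP e.
by rewrite -(pexpr_eq1 m0) // -normrX e normr1.
Qed.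

(** * Reduction of the continuous q-Jacobi polynomials to the algebraic form *)

Section CqJacobiValues.
Variables (R : realType) (n : nat) (q l alpha beta : R[i]).
Hypotheses (q0 : q != 0) (hq : forall m, (0 < m)%N -> q ^+ m != 1) (ql : cexp l = q).
Hypothesis (denP : cqJacobi_den (q ^+ 2) (2 * l) n alpha beta != 0).

Local Notation A := (qpow l alpha).
Local Notation B := (qpow l beta).
Local Notation s := (qpow l (1 / 2)).

Lemma qpow1 : qpow l 1 = q.
Proof. by rewrite /qpow mul1r. Qed.

Lemma qpow_half_sqr : s ^+ 2 = q.
Proof. by rewrite expr2 -qpowD -qpow1; congr qpow; field. Qed.

(** (q^2;q^2)_n splits into (q,-q;q)_n. The other two symbols form (-ABq;q)_(2n), split by parity on
    the left and cut in the middle on the right. *)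
Lemma cqJacobi_denE : cqJacobi_den (q ^+ 2) (2 * l) n alpha beta
  = qpochs [:: q; - q; - (A * B * q); - (A * B) * q ^+ n.+1] q n.
Proof.
rewrite /cqJacobi_den !qpow_scale qpochs3 qpochs4 qpoch_sqr.
have -> : qpow l (2 * ((alpha + beta + 1) / 2)) = A * B * q.
  by rewrite -qpow1 -!qpowD; congr qpow; field.
have -> : qpow l (2 * ((alpha + beta + 2) / 2)) = A * B * q * q.
  by rewrite -qpow1 -!qpowD; congr qpow; field.
rewrite -[RHS]mulrA -[LHS]mulrA; congr (_ * _).
rewrite -(mulNr (A * B * q) q) -qpoch_double -addnn qpochD; congr (_ * qpoch _ _ _).
by rewrite exprS; ring.
Qed.

Lemma cqJacobi_at z : z != 0 ->
  cqJacobi (q ^+ 2) (2 * l) n alpha beta ((z + z^-1) / 2)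
  = (A * s) ^+ n / qpochs [:: q; - q; - (A * B * q); - (A * B) * q ^+ n.+1] q n
    * askey_wilson_z n (A * s) (A * s * q) (- (B * s)) (- (B * s * q)) (q ^+ 2) z.
Proof.
move=> z0; rewrite /cqJacobi cqJacobi_denE.
rewrite askey_wilsonE; last exact: z0.
rewrite (qpow_scale l (_ * n%:R)).
rewrite !(qpow_scale l (_ + _)).
have -> : qpow l (2 * ((alpha / 2 + 1 / 4) * n%:R)) = (A * s) ^+ n.
  by rewrite mulrA qpowMn -qpowD; congr (qpow _ _ ^+ _); field.
have E1 t : qpow l (2 * (t / 2 + 1 / 4)) = qpow l t * s.
  by rewrite -qpowD; congr qpow; field.
have E3 t : qpow l (2 * (t / 2 + 3 / 4)) = qpow l t * s * q.
  by rewrite -qpow1 -!qpowD; congr qpow; field.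
by rewrite !E1 !E3.
Qed.

End CqJacobiValues.

Theorem corollary2p8 (R : realType) (n : nat) (q logq alpha beta : R[i])
  (q_neq0 : q != 0) (normq_neq1 : `|q| != 1) (logqE : cexp logq = q)
  (denP : cqJacobi_den (q ^+ 2) (2 * logq) n alpha beta != 0)
  (den12 : qpochs [:: q; - qpow logq (alpha + beta + 1)] q n != 0)
  (den34 : qpochs [:: q; - q] q n != 0) :
  [/\ cqJacobi (q ^+ 2) (2 * logq) n alpha beta
        ((qpow logq (1 / 2) + qpow logq (- (1 / 2))) / 2)
      = qpow logq alpha ^+ n
        * (qpochs [:: qpow logq (alpha + 1); - qpow logq (beta + 1)] q n
           / qpochs [:: q; - qpow logq (alpha + beta + 1)] q n),
      cqJacobi (q ^+ 2) (2 * logq) n alpha beta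
        (- ((qpow logq (1 / 2) + qpow logq (- (1 / 2))) / 2))
      = (- qpow logq alpha) ^+ n
        * (qpochs [:: - qpow logq (alpha + 1); qpow logq (beta + 1)] q n
           / qpochs [:: q; - qpow logq (alpha + beta + 1)] q n),
      cqJacobi (q ^+ 2) (2 * logq) n alpha beta
        ((qpow logq (alpha + 1 / 2) + qpow logq (- alpha - 1 / 2)) / 2)
      = qpochs [:: qpow logq (alpha + 1); - qpow logq (alpha + 1)] q n
        / qpochs [:: q; - q] q n
    & cqJacobi (q ^+ 2) (2 * logq) n alpha beta
        (- ((qpow logq (beta + 1 / 2) + qpow logq (- beta - 1 / 2)) / 2))
      = (- qpow logq (alpha - beta)) ^+ n
        * (qpochs [:: qpow logq (beta + 1); - qpow logq (beta + 1)] q n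
           / qpochs [:: q; - q] q n)].
Proof.
have hq m : (0 < m)%N -> q ^+ m != 1 by exact: expf_neq1_norm.
have hp m : (0 < m)%N -> (q ^+ 2) ^+ m != 1.
  by move=> m0; rewrite -exprM hq // muln_gt0.
have p0 : q ^+ 2 != 0 by exact: expf_neq0.
have q1 := qpow1 logqE; have sq := qpow_half_sqr logqE.
have at_ z := @cqJacobi_at _ n q logq alpha beta logqE z.
have mA : qpow logq (alpha + 1) = qpow logq alpha * q by rewrite qpowD q1.
have mB : qpow logq (beta + 1) = qpow logq beta * q by rewrite qpowD q1.
have mAB : qpow logq (alpha + beta + 1) = qpow logq alpha * qpow logq beta * q.
  by rewrite !qpowD q1.
have aC : qpow logq (alpha + 1 / 2) = qpow logq alpha * qpow logq (1 / 2) by rewrite qpowD.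
have bC : qpow logq (beta + 1 / 2) = qpow logq beta * qpow logq (1 / 2) by rewrite qpowD.
have nC t : qpow logq (- t - 1 / 2) = (qpow logq (t + 1 / 2))^-1.
  by rewrite -opprD qpowN.
have abC : qpow logq (alpha - beta) = qpow logq alpha / qpow logq beta by rewrite qpowD qpowN.
rewrite !nC aC bC abC mA mB mAB qpowN.
have A0 := qpow_neq0 logq alpha; have B0 := qpow_neq0 logq beta.
have s0 := qpow_neq0 logq (1 / 2).
move: denP; rewrite (cqJacobi_denE n alpha beta logqE) => den0.
(* Negating x amounts to negating z. *)
have oppE (z : R[i]) : - ((z + z^-1) / 2) = (- z + (- z)^-1) / 2.
  by rewrite invrN -opprD mulNr.
move: (qpow logq alpha) (qpow logq beta) (qpow logq (1 / 2)) A0 B0 s0 sq den0 at_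
  => A B s A0 B0 s0 sq den0 at_.
split.
- rewrite at_; last exact: s0.
  exact: jacobi_value1.
- rewrite oppE at_; last by rewrite oppr_eq0; exact: s0.
  exact: jacobi_value2.
- rewrite at_; last by apply: mulf_neq0; [exact: A0|exact: s0].
  exact: jacobi_value3.
- rewrite oppE at_; last by rewrite oppr_eq0; apply: mulf_neq0; [exact: B0|exact: s0].
  exact: jacobi_value4.
Qed.
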